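(* Let $S$ be a countable scattered chain of finite Hausdorff rank. If $T(1, S) = 1$ then $S$ has finite big Ramsey spectrum, that is, $T(n, S) < \infty$ for every integer $n \ge 1$.
   Context: A chain is a strictly linearly ordered set. A chain is scattered if $\mathbb{Q}$ does not embed into it. Hausdorff rank: for a chain $A$ and chains $B_a$ ($a \in A$), $\sum_{a \in A} B_a$ is the set $\bigcup_{a \in A} (\{a\} \times B_a)$ ordered lexicographically. Let $\mathcal{H}_0$ consist of the empty chain and the one-element chain, and for an ordinal $\alpha > 0$ let $\mathcal{H}_\alpha = \{\sum_{i \in \mathbb{Z}} S_i : S_i \in \bigcup_{\beta<\alpha} \mathcal{H}_\beta \text{ for all } i \in \mathbb{Z}\}$ (up to isomorphism). For a countable scattered chain $S$, its Hausdorff rank $r_H(S)$ is the least $\alpha$ with $S \in \mathcal{H}_\alpha$ (such an $\alpha$ exists by Hausdorff's theorem); $S$ has finite Hausdorff rank if $r_H(S) < \omega$. Big Ramsey degree: an integer $n \ge 1$ is identified with the chain $0<1<\dots<n-1$, and $\mathrm{Emb}(n, C)$ is the set of all order embeddings of $n$ into a chain $C$. $T(n, C)$ is the least integer $t \ge 1$ such that for every integer $k \ge 2$ and every coloring $\chi : \mathrm{Emb}(n, C) \to \{0,\dots,k-1\}$ there is a $U \subseteq C$ order-isomorphic to $C$ with $|\chi(\mathrm{Emb}(n, U))| \le t$; if no such $t$ exists, $T(n, C) = \infty$. *)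

(* Defs.v *)
From mathcomp Require Import all_boot all_order all_algebra.
From mathcomp Require Import boolp classical_sets functions cardinality.

Set Implicit Arguments.
Unset Strict Implicit.
Unset Printing Implicit Defensive.

Local Open Scope nat_scope.
Local Open Scope classical_set_scope.

(* A chain is an [orderType]; an order embedding preserves and reflects [<]. *)
Definition order_embedding (dA dB : Order.disp_t) (A : orderType dA)
    (B : orderType dB) (f : A -> B) : Prop :=
  {mono f : x y / (x < y)%O}.

Definition order_isomorphic (dA dB : Order.disp_t) (A : orderType dA)
    (B : orderType dB) : Prop :=
  exists2 f : A -> B, bijective f & order_embedding f.

Definition scattered (d : Order.disp_t) (C : orderType d) : Prop :=
  ~ exists f : rat -> C, order_embedding f.

(* [hausdorff_class n C] says that C belongs, up to isomorphism, to the
   Hausdorff class H_n.  Only finite indices n are needed to say that the rank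
   is below omega, and H_n for finite n only refers to H_m with m < n.
   The order on [{i : int & F i}] is the library's lexicographic order, so this
   type is the sum over Z of the chains F i. *)
Inductive hausdorff_class : nat -> forall d : Order.disp_t, orderType d -> Prop :=
| hausdorff_class_empty (d : Order.disp_t) (C : orderType d) :
    (C -> False) -> hausdorff_class 0 C
| hausdorff_class_one (d : Order.disp_t) (C : orderType d) (x : C) :
    (forall y : C, y = x) -> hausdorff_class 0 C
| hausdorff_class_sum (n : nat) (d d' : Order.disp_t) (C : orderType d)
    (F : int -> orderType d') :
    0 < n ->
    (forall i : int, exists2 m : nat, m < n & hausdorff_class m (F i)) ->
    order_isomorphic C {i : int & F i} ->
    hausdorff_class n C.

Definition has_hausdorff_rank (d : Order.disp_t) (C : orderType d) (n : nat) :
    Prop :=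
  hausdorff_class n C /\ (forall m : nat, hausdorff_class m C -> n <= m).

Definition finite_hausdorff_rank (d : Order.disp_t) (C : orderType d) : Prop :=
  exists n : nat, has_hausdorff_rank C n.

Definition Emb (n : nat) (d : Order.disp_t) (C : orderType d) : Type :=
  {e : 'I_n -> C | order_embedding e}.

(* Emb(n, U) seen inside Emb(n, C). *)
Definition Emb_in (n : nat) (d : Order.disp_t) (C : orderType d) (U : set C) :
    set (Emb n C) :=
  [set e | forall i : 'I_n, U (sval e i)].

(* U, with the order induced from C, is order-isomorphic to C. *)
Definition order_copy (d : Order.disp_t) (C : orderType d) (U : set C) : Prop :=
  exists2 f : C -> C, order_embedding f & range f = U.

Definition big_ramsey_bound (n : nat) (d : Order.disp_t) (C : orderType d)
    (t : nat) : Prop :=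
  forall k : nat, 2 <= k -> forall chi : Emb n C -> 'I_k,
    exists2 U : set C, order_copy U & (chi @` Emb_in U #<= `I_t)%card.

(* T(n, C): the least admissible t >= 1, with [None] standing for infinity. *)
Definition big_ramsey_degree (n : nat) (d : Order.disp_t) (C : orderType d) :
    option nat :=
  match pselect (exists t : nat, (1 <= t) && `[< big_ramsey_bound n C t >]) with
  | left ex_t => Some (ex_minn ex_t)
  | right _ => None
  end.

Definition finite_big_ramsey_spectrum (d : Order.disp_t) (C : orderType d) :
    Prop :=
  forall n : nat, 1 <= n -> exists t : nat, big_ramsey_degree n C = Some t.

(* Main.v *)
(** For a word [w] over {omega, omega^*}, let [L_w] be the corresponding
    lexicographic power of nat.  By induction on the Hausdorff rank, a chain [C]
    of finite rank splits into finitely many classes, each of which embeds in a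
    finite sum of copies of some [L_w] that embeds back in [C]: in a Z-sum, the
    summands meeting a given class extend infinitely far to the right, or to the
    left, or are finite in number.  If [T(1, S) = 1], then [S] embeds in one
    class, hence in one copy, so [S] is equimorphic to a single [L_w].

    An n-tuple of vectors of length [m] is given by an increasing sequence of
    [n * m] naturals and the pattern placing its terms in the [n] vectors.
    Ramsey's theorem for such sequences makes the colour depend on the pattern
    alone once all coordinates lie in a suitable infinite set [H], and the
    vectors with coordinates in [H] form a copy of [L_w]. *)

Require Import Defs.
From mathcomp Require Import all_boot all_order all_algebra.
From mathcomp Require Import boolp classical_sets functions cardinality.

Set Implicit Arguments.
Unset Strict Implicit.
Unset Printing Implicit Defensive.

Local Open Scope nat_scope.

(** * Ramsey's theorem for increasing sequences of naturals *)

Lemma exists_increasing (P : nat -> Prop) :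
  (forall n, exists2 m, n <= m & P m) ->
  exists2 h : nat -> nat, {homo h : x y / x < y} & forall i, P (h i).
Proof.
move=> /(_ _)/cid2-/all_sig2[next next_ge nextP].
pose h i := iter i (next \o succn) (next 0).
exists h; last by case=> [|i]; apply: nextP.
by apply: homo_ltn; [exact: ltn_trans | move=> i; exact: next_ge].
Qed.

Lemma infinite_pigeonhole (K : finType) (c : nat -> K) :
  exists k, forall n, exists2 m, n <= m & c m = k.
Proof.
apply: contrapT => /forallNP noK.
have /choice[b bP] k : exists n, forall m, n <= m -> c m <> k.
  apply: contrapT => /forallNP nob; apply: (noK k) => n.
  by apply: contrapT => nom; apply: (nob n) => m le_nm cm; apply: nom; exists m.
apply: (bP (c (\max_k b k)) (\max_k b k)) => //.
exact: (leq_bigmax (c (\max_k b k))).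
Qed.

(** Induction on [s]: along the diagonal [a] of nested infinite sets, the colour of a sequence
    depends only on its first term; the pigeonhole principle then makes it constant along a
    subsequence. *)
Theorem infinite_ramsey (K : finType) (s : nat) (c : seq nat -> K) :
  exists2 h : nat -> nat, {homo h : x y / x < y} &
  exists k, forall l, sorted ltn l -> size l = s -> c (map h l) = k.
Proof.
elim: s c => [|s IHs] c.
  by exists id => //; exists (c [::]) => l _ /size0nil->.
have /choice[next nextP] (h : nat -> nat) :
    exists h'k : (nat -> nat) * K, {homo h'k.1 : x y / x < y} /\
      forall l, sorted ltn l -> size l = s ->
        c (h 0 :: map (h \o succn \o h'k.1) l) = h'k.2.
  have [h' h'_inc [k kP]] := IHs (fun l => c (h 0 :: map (h \o succn) l)).
  by exists (h', k); split=> // l l_sorted l_size; rewrite map_comp kP.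
(* [res i] enumerates the i-th set of a decreasing sequence of infinite sets. *)
pose res i := iter i (fun h : nat -> nat => h \o succn \o (next h).1) id.
have res_inc i : {homo res i : x y / x < y}.
  elim: i => [|i IHi] x y lt_xy //=; apply: IHi => /=; rewrite ltnS.
  by case: (nextP (res i)) => + _; apply.
have resD i j : exists2 h : nat -> nat, {homo h : x y / x < y} &
    res (i + j) = res i \o h.
  elim: j => [|j [h h_inc hE]]; first by exists id => //; rewrite addn0.
  exists (h \o succn \o (next (res (i + j))).1); last by rewrite addnS /= hE.
  move=> x y lt_xy /=; apply: h_inc; rewrite ltnS.
  by case: (nextP (res (i + j))) => + _; apply.
pose a i := res i 0.
have a_inc : {homo a : x y / x < y}.
  apply: homo_ltn; first exact: ltn_trans.
  by move=> j; rewrite /a /=; apply: res_inc.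
have aP i l : sorted ltn l -> size l = s -> all (ltn i) l ->
    c (a i :: map a l) = (next (res i)).2.
  move=> l_sorted l_size l_gt.
  (* Beyond index [i] the diagonal stays in the range of [res i.+1]; [pre] takes preimages there,
     with dummy value 0 elsewhere. *)
  have /choice[pre preE] j : exists x, i < j -> a j = res i.+1 x.
    case: (ltnP i j) => [lt_ij|_]; last by exists 0.
    have [h _ hE] := resD i.+1 (j - i.+1); exists (h 0) => _.
    by rewrite /a -{1}(subnKC lt_ij) hE.
  have mapE : map a l = map (res i.+1) (map pre l).
    by rewrite -map_comp; apply/eq_in_map => j /(allP l_gt) /preE.
  rewrite mapE; case: (nextP (res i)) => _; apply; last by rewrite size_map.
  have res_ltn := leqW_mono (leq_mono (res_inc i.+1)).
  have : sorted ltn (map a l) by apply: (homo_sorted a_inc).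
  by rewrite mapE sorted_map; under eq_sorted => x y do rewrite /= res_ltn.
have [k /exists_increasing[q q_inc qk]] :=
  infinite_pigeonhole (fun i => (next (res i)).2).
exists (a \o q); first by move=> x y /q_inc/a_inc.
exists k => -[|i l] //= il_path [l_size].
rewrite map_comp aP ?qk //.
- by apply: (homo_sorted q_inc); apply: path_sorted il_path.
- by rewrite size_map.
- rewrite all_map; apply/allP => j /(allP (order_path_min ltn_trans il_path)).
  exact: q_inc.
Qed.

(** * Lexicographic powers of nat and colourings by labels *)

(* [lexlt w] is the lexicographic order on [nat ^ size w], with the i-th
   coordinate reversed when [nth w i] is [false]; the entries of a vector beyond
   [size w] are ignored. *)
Fixpoint lexlt (w : seq bool) (u v : nat -> nat) : bool :=
  if w is b :: w' then
    (if b then u 0 < v 0 else v 0 < u 0) ||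
    (u 0 == v 0) && lexlt w' (u \o succn) (v \o succn)
  else false.

Lemma eq_lexlt w u u' v v' :
    (forall i, i < size w -> u i = u' i) -> (forall i, i < size w -> v i = v' i) ->
  lexlt w u v = lexlt w u' v'.
Proof.
elim: w u u' v v' => //= b w IHw u u' v v' uE vE; rewrite uE // vE //.
by congr (_ || _ && _); apply: IHw => i lt_iw /=; [apply: uE | apply: vE].
Qed.

Lemma lexlt_homo w u v (h : nat -> nat) : {homo h : x y / x < y} ->
  lexlt w u v -> lexlt w (h \o u) (h \o v).
Proof.
move=> h_inc; elim: w u v => //= b w IHw u v /orP[lt_uv|/andP[/eqP-> /IHw->]].
  by apply/orP; left; case: b lt_uv => /h_inc.
by rewrite eqxx orbT.
Qed.

(* Entries [None] of a label mark the levels of the iterated sum at which the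
   class meets only finitely many summands. *)
Definition word (n : nat) (l : n.-tuple (option bool)) : seq bool := pmap id l.

(* Each colour class embeds in a finite sum of copies of the chain of its word
   (coordinate 0 is the index of the copy), and that chain embeds back in C. *)
Definition word_colouring (n : nat) (d : Order.disp_t) (C : orderType d)
    (col : C -> n.-tuple (option bool)) : Prop :=
  forall l,
    (exists pg : nat * (C -> nat -> nat),
       (forall x, col x = l -> pg.2 x 0 < pg.1) /\
       forall x y, col x = l -> col y = l -> (x < y)%O ->
         lexlt (true :: word l) (pg.2 x) (pg.2 y)) /\
    ((exists x, col x = l) -> exists f : (nat -> nat) -> C,
       forall u v, lexlt (word l) u v -> (f u < f v)%O).

Lemma word_colouring_subsingleton (n : nat) (d : Order.disp_t) (C : orderType d) :
    (forall x y : C, x = y) ->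
  exists col : C -> n.-tuple (option bool), word_colouring col.
Proof.
move=> Ceq; exists (fun=> [tuple of nseq n None]) => l; split.
  exists (1, fun=> id); split=> // x y _ _.
  by rewrite (Ceq x y) Order.POrderTheory.ltxx.
case=> x <-; exists (fun=> x) => u v.
by have -> : word [tuple of nseq n None] = [::] by rewrite /word /=; elim: (n).
Qed.

Lemma word_colouring_iso (n : nat) (d d' : Order.disp_t) (C : orderType d)
    (D : orderType d') (col : D -> n.-tuple (option bool)) :
    order_isomorphic C D -> word_colouring col ->
  exists col' : C -> n.-tuple (option bool), word_colouring col'.
Proof.
case=> phi [psi phiK psiK] phi_mono colP; exists (col \o phi) => l.
have [[[p g] [/= g_lt g_mono]] f_ex] := colP l; split.
  exists (p, g \o phi); split=> [x|x y] /=; first exact: g_lt.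
  by move=> xl yl lt_xy; apply: g_mono; rewrite ?phi_mono.
case=> x xl; have [|f f_mono] := f_ex; first by exists (phi x).
by exists (psi \o f) => u v /f_mono; rewrite -phi_mono /= !psiK.
Qed.

Definition vcons (a : nat) (u : nat -> nat) (i : nat) : nat :=
  if i is i'.+1 then u i' else a.

Lemma vconsK a u : vcons a u \o succn = u.
Proof. by apply/funext. Qed.

Lemma lexlt_cons b w u v : lexlt (b :: w) u v =
  (if b then u 0 < v 0 else v 0 < u 0) ||
  (u 0 == v 0) && lexlt w (u \o succn) (v \o succn).
Proof. by []. Qed.

Lemma lexlt_vcons b w a a' u u' : lexlt (b :: w) (vcons a u) (vcons a' u') =
  (if b then a < a' else a' < a) || (a == a') && lexlt w u u'.
Proof. by rewrite /= !vconsK. Qed.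

(** * Labels for sums over Z and induction on the rank *)

Definition mkint (b : bool) (k : nat) : int := if b then Posz k else Negz k.
Definition int_sgn (i : int) : bool := if i is Posz _ then true else false.
Definition int_mag (i : int) : nat := match i with Posz k | Negz k => k end.

Lemma mkintK i : mkint (int_sgn i) (int_mag i) = i.
Proof. by case: i. Qed.

Lemma ltmkint b k k' : (mkint b k < mkint b k')%O = if b then k < k' else k' < k.
Proof. by case: b. Qed.

(** Serves to number consecutively the copies found in successive summands, [p k] of them in summand
    [k]. *)
Lemma partial_sums_lt (p : nat -> nat) i j q q' : q < p i ->
  i < j -> \sum_(k < i) p k + q < \sum_(k < j) p k + q'.
Proof.
move=> lt_qp lt_ij; apply: (@leq_trans (\sum_(k < i.+1) p k)).
  by rewrite big_ord_recr ltn_add2l.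
apply: leq_trans (leq_addr _ _).
rewrite -!(big_mkord xpredT p) (@big_cat_nat _ _ _ i.+1 0 j) //=.
exact: leq_addr.
Qed.

Lemma lt_existT (d : Order.disp_t) (F : int -> orderType d) i (a b : F i) :
  (existT F i a < existT F i b :> {i & F i})%O = (a < b)%O.
Proof.
by rewrite Order.SigmaOrder.ltEsig /= Order.POrderTheory.lexx tagged_asE.
Qed.

Lemma lt_sigT (d : Order.disp_t) (F : int -> orderType d) (x y : {i & F i}) :
    (x < y)%O ->
  (tag x < tag y)%O \/ exists i (a b : F i),
    [/\ x = existT _ i a, y = existT _ i b & (a < b)%O].
Proof.
case: x y => [i a] [j b]; rewrite Order.SigmaOrder.ltEsig /=.
case: (Order.TotalTheory.ltgtP i j) => [||ij] //=; first by left.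
by subst j; rewrite tagged_asE => lt_ab; right; exists i, a, b.
Qed.

(** The new entry is [Some b] if the old label occurs arbitrarily far out in the half [b] of Z
    containing the point: the finite sums found there line up along omega or omega^*. Otherwise it
    is [None], only finitely many summands are met, and their finite sums add up to a finite sum. *)
Lemma word_colouring_sum (n : nat) (d : Order.disp_t) (F : int -> orderType d) :
    (forall i, exists col : F i -> n.-tuple (option bool), word_colouring col) ->
  exists col : {i & F i} -> n.+1.-tuple (option bool), word_colouring col.
Proof.
move=> /(_ _)/cid-/all_sig[col colP].
pose pg i l := sval (cid (colP i l).1).
have pg_lt i l a : col i a = l -> (pg i l).2 a 0 < (pg i l).1.
  by have [+ _] := svalP (cid (colP i l).1); apply.
have pg_mono i l a b : col i a = l -> col i b = l -> (a < b)%O ->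
    lexlt (true :: word l) ((pg i l).2 a) ((pg i l).2 b).
  by have [_] := svalP (cid (colP i l).1); apply.
pose often b l := forall K, exists2 k, K <= k &
  exists a, col (mkint b k) a = l.
pose sign b l := if `[<often b l>] then Some b else None.
pose ncol (x : {i & F i}) :=
  cons_tuple (sign (int_sgn (tag x)) (col _ (tagged x))) (col _ (tagged x)).
exists ncol => lo; case/tupleP: lo => o l.
have ncolP x : ncol x = [tuple of o :: l] ->
    sign (int_sgn (tag x)) l = o /\ col _ (tagged x) = l.
  by move=> /(congr1 val)[<- /val_inj->].
split; last first.
  case=> -[i a] /ncolP[/= so al].
  case: o ncolP so => [b|] _; rewrite /sign; case: asboolP => //; last first.
    move=> _ _; have [_ [|f f_mono]] := colP i l; first by exists a.
    exists (fun u => existT _ i (f u)) => u v /f_mono.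
    by rewrite lt_existT.
  move=> oft [b_def]; subst b.
  (* The leading coordinate of a vector selects one of infinitely many summands that each contain a
     copy of the chain of [l]. *)
  have [k k_inc kP] := exists_increasing oft.
  have /(_ _)/cid-/all_sig[f f_mono] j :
      exists f : (nat -> nat) -> F (mkint (int_sgn i) (k j)),
        forall u v, lexlt (word l) u v -> (f u < f v)%O.
    by have [_] := colP (mkint (int_sgn i) (k j)) l; apply.
  exists (fun u => existT F _ (f (u 0) (u \o succn))) => u v.
  rewrite /word /= -/(word l) => /orP[lt_uv|/andP[/eqP<- /f_mono]].
    rewrite Order.SigmaOrder.ltEsig /=.
    have lt_k : (mkint (int_sgn i) (k (u 0)) < mkint (int_sgn i) (k (v 0)))%O.
      by rewrite ltmkint; case: (int_sgn i) lt_uv => /k_inc.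
    rewrite (Order.POrderTheory.ltW lt_k) /=.
    by rewrite Order.TotalTheory.leNgt lt_k.
  by rewrite lt_existT.
case: o ncolP => [b|] ncolP.
  pose q (x : {i & F i}) := (pg (tag x) l).2 (tagged x) 0.
  (* Copies are numbered outwards from the origin. On the negative half the numbering inside a
     summand is reversed too, to match the reversed leading coordinate. *)
  pose block (x : {i & F i}) :=
    \sum_(k < int_mag (tag x)) (pg (mkint b k) l).1 +
    if b then q x else (pg (tag x) l).1 - (q x).+1.
  exists (1, fun x => vcons 0 (vcons (block x)
                       ((pg (tag x) l).2 (tagged x) \o succn))); split=> // x y.
  move=> /ncolP[sx xl] /ncolP[sy yl] lt_xy.
  rewrite (_ : word _ = b :: word l) // !lexlt_vcons ltnn eqxx /=.
  have q_lt z : col _ (tagged z) = l -> q z < (pg (tag z) l).1 by apply: pg_lt.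
  have sE i : sign (int_sgn i) l = Some b -> i = mkint b (int_mag i).
    by rewrite /sign; case: asboolP => // _ [<-]; rewrite mkintK.
  have rest_lt z : col _ (tagged z) = l -> sign (int_sgn (tag z)) l = Some b ->
      (if b then q z else (pg (tag z) l).1 - (q z).+1) <
      (pg (mkint b (int_mag (tag z))) l).1.
    move=> /q_lt zl /sE <-; case: (b) => //.
    by rewrite ltn_subrL /= (leq_ltn_trans _ zl).
  have [lt_tag|[i [a1 [a2 [xE yE lt_a]]]]] := lt_sigT lt_xy.
    apply/orP; left; move: lt_tag; rewrite {1}(sE _ sx) {1}(sE _ sy) ltmkint.
    move: (rest_lt x xl sx) (rest_lt y yl sy); rewrite /block.
    by case: (b) => qx qy; apply: (@partial_sums_lt (fun k => (pg (mkint _ k) l).1)).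
  move: (q_lt x xl) (q_lt y yl); rewrite /block /q; subst x y => /= qx qy.
  have := pg_mono i l a1 a2 xl yl lt_a; rewrite lexlt_cons.
  case/orP=> [lt_q|/andP[/eqP-> ->]].
    apply/orP; left; case: (b); rewrite ltn_add2l // ltn_sub2lE //.
  by rewrite eqxx orbT.
have [K KP] : exists K, forall x, ncol x = [tuple of None :: l] ->
    int_mag (tag x) < K.
  have /choice[K KP] b : exists K, forall k (a : F (mkint b k)),
      col _ a = l -> sign b l = None -> k < K.
    rewrite /sign; case: asboolP => [_|]; first by exists 0.
    move=> /existsNP[K noK]; exists K => k a al _.
    by rewrite ltnNge; apply/negP => le_Kk; apply: noK; exists k => //; exists a.
  exists (K true + K false) => -[i a] /ncolP[/= si al].
  rewrite -[i]mkintK in a al; have := KP _ _ a al si.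
  by case: (i) => k /= lt_k; apply: (leq_trans lt_k); rewrite ?leq_addr ?leq_addl.
(* Translation by [K], faithful on the integers from -K to K-1, which it carries onto the naturals
   below [K + K]; [unpos] inverts it. *)
pose pos (i : int) := match i with Posz k => K + k | Negz k => K - k.+1 end.
pose unpos j : int := if K <= j then Posz (j - K) else Negz (K - j.+1).
have unposK i : int_mag i < K -> unpos (pos i) = i.
  rewrite /unpos; case: i => k /= lt_kK; first by rewrite leq_addr addKn.
  by rewrite leqNgt ltn_subrL (leq_ltn_trans _ lt_kK) //= subnSK // subKn // ltnW.
have pos_mono i j : int_mag i < K -> int_mag j < K -> (i < j)%O -> pos i < pos j.
  case: i j => [i|i] [j|j] //= ltiK ltjK lt_ij.
  - by rewrite ltn_add2l.
  - by apply: (@leq_trans K); rewrite ?leq_addr // ltn_subrL (leq_ltn_trans _ ltiK).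
  - by rewrite ltn_sub2lE // ltnS.
have pos_lt i : int_mag i < K -> pos i < K + K.
  case: i => i /= lt_iK; first by rewrite ltn_add2l.
  by apply: (@leq_trans K); rewrite ?leq_addr // ltn_subrL (leq_ltn_trans _ lt_iK).
pose size_at j := (pg (unpos j) l).1.
pose block (x : {i & F i}) :=
  \sum_(j < pos (tag x)) size_at j + (pg (tag x) l).2 (tagged x) 0.
have block_lt x j : ncol x = [tuple of None :: l] -> pos (tag x) < j ->
    block x < \sum_(k < j) size_at k + 0.
  move=> xl lt_j; apply: partial_sums_lt => //; rewrite /size_at unposK ?KP //.
  by have [_] := ncolP _ xl; apply: pg_lt.
exists (\sum_(j < K + K) size_at j,
        fun x => vcons (block x) ((pg (tag x) l).2 (tagged x) \o succn)).
split=> [x xl|x y xl yl lt_xy] /=.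
  by rewrite -[X in _ < X]addn0; apply: block_lt; rewrite ?pos_lt ?KP.
rewrite !vconsK (_ : word _ = word l) //.
have [lt_tag|[i [a1 [a2 [xE yE lt_a]]]]] := lt_sigT lt_xy.
  apply/orP; left.
  apply: leq_trans (block_lt x _ xl (pos_mono _ _ (KP x xl) (KP y yl) lt_tag)) _.
  by rewrite leq_add2l.
have [_ {}xl] := ncolP _ xl; have [_ {}yl] := ncolP _ yl.
rewrite /block; subst x y => /=; rewrite ltn_add2l eqn_add2l.
exact: pg_mono.
Qed.

(** The summands of one sum may have different ranks but need labels of equal length, hence a common
    bound [n]; chains with at most one point get [None] throughout. *)
Lemma hausdorff_word_colouring (n m : nat) (d : Order.disp_t) (C : orderType d) :
    hausdorff_class m C -> m <= n ->
  exists col : C -> n.-tuple (option bool), word_colouring col.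
Proof.
elim: n m d C => [|n IHn] m d C
  [{}d {}C C0|{}d {}C x Cx|{}m {}d d' {}C F m_gt0 F_class C_iso] le_mn.
- by apply: word_colouring_subsingleton => x; case: (C0 x).
- by apply: word_colouring_subsingleton => y z; rewrite (Cx y) (Cx z).
- by move: m_gt0; rewrite ltnNge le_mn.
- by apply: word_colouring_subsingleton => x; case: (C0 x).
- by apply: word_colouring_subsingleton => y z; rewrite (Cx y) (Cx z).
- have [i|col] := @word_colouring_sum n d' F; last exact: word_colouring_iso.
  have [k lt_km /IHn] := F_class i; apply.
  by rewrite -ltnS (leq_trans lt_km).
Qed.

(** * Indivisibility from a bound of one colour on points *)

Lemma order_embedding_homo (d d' : Order.disp_t) (A : orderType d)
    (B : orderType d') (f : A -> B) :
  {homo f : x y / (x < y)%O} -> order_embedding f.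
Proof. by move=> /Order.TotalTheory.le_mono/Order.POrderTheory.leW_mono. Qed.

Lemma card_le_I1 (T : Type) (A : set T) : (A #<= `I_1)%card ->
  forall x y, A x -> A y -> x = y.
Proof.
move=> /pcard_leP[f] x y Ax Ay.
have := @inj _ _ _ f x y; rewrite !inE; apply=> //.
move: (@funS _ _ _ _ f x Ax) (@funS _ _ _ _ f y Ay) => /=.
by case: (f x) (f y) => [] [].
Qed.

Lemma big_ramsey_bound_indivisible (d : Order.disp_t) (S : orderType d)
    (K : finType) (c : S -> K) :
    big_ramsey_bound 1 S 1 ->
  exists2 F : S -> S, {homo F : x y / (x < y)%O} &
    forall x y, c (F x) = c (F y).
Proof.
(* Two spare colours ensure that there are at least two, however small [K] is. *)
move=> /(_ #|K|.+2 isT (fun e => inord (enum_rank (c (sval e ord0))))).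
case=> U [F F_emb <-{U}] /card_le_I1 chi_eq.
exists F => [x y|x y]; first by rewrite F_emb.
have const_emb z : order_embedding (fun _ : 'I_1 => F z).
  by move=> i j; rewrite !ord1 !Order.POrderTheory.ltxx.
have := chi_eq _ _ (ex_intro2 _ _ (exist _ _ (const_emb x)) _ erefl)
                   (ex_intro2 _ _ (exist _ _ (const_emb y)) _ erefl).
move=> /(_ (fun=> ex_intro2 _ _ x I erefl) (fun=> ex_intro2 _ _ y I erefl)).
move=> /(congr1 (@nat_of_ord _)) /=.
have rank_lt z : enum_rank (c z) < #|K|.+2 by rewrite (leq_trans (ltn_ord _)) // ltnW.
by rewrite !inordK // => /val_inj/enum_rank_inj.
Qed.

(** * Finite bounds for chains equimorphic to a lexicographic power *)

(** Coordinates of a tuple of vectors may coincide; padding with larger naturals restores the exact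
    length required by Ramsey's theorem. *)
Lemma exists_sorted_cover (v : seq nat) :
  exists B, [/\ sorted ltn B, size B = size v & {subset v <= B}].
Proof.
pose w := undup v ++ iota (\max_(a <- v) a).+1 (size v - size (undup v)).
exists (sort leq w); split.
- rewrite ltn_sorted_uniq_leq sort_uniq sort_sorted ?andbT; last exact: leq_total.
  rewrite cat_uniq undup_uniq iota_uniq andbT /=.
  apply/hasPn => a; rewrite mem_iota => /andP[lt_a _]; rewrite mem_undup.
  apply/negP => va; move: lt_a; rewrite ltnNge.
  by rewrite (@leq_bigmax_seq _ v xpredT id a va isT).
- by rewrite size_sort size_cat size_iota subnKC // size_undup.
- by move=> a va; rewrite mem_sort mem_cat mem_undup va.
Qed.

Theorem big_ramsey_bound_word (n : nat) (d : Order.disp_t) (S : orderType d)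
    (w : seq bool) (g : S -> nat -> nat) (f : (nat -> nat) -> S) :
    (forall x y, (x < y)%O -> lexlt w (g x) (g y)) ->
    (forall u v, lexlt w u v -> (f u < f v)%O) ->
  exists2 t, 1 <= t & big_ramsey_bound n S t.
Proof.
move=> g_mono f_mono; set m := size w.
pose pattern := {ffun 'I_n * 'I_m -> 'I_(n * m)}.
exists #|pattern|.+1 => // k k_ge2 chi.
(* A pattern need not yield an embedding; such maps get the default colour 0. *)
pose chi' (e : 'I_n -> S) : 'I_k :=
  if pselect (order_embedding e) is left emb then chi (exist _ e emb)
  else Ordinal (ltnW k_ge2).
pose vec (A : seq nat) (tau : pattern) j i :=
  if insub i is Some i' then nth 0 A (tau (j, i')) else 0.
(* The colour of a sequence is the table of colours of all its patterns, so that a single [h] serves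
   every pattern. *)
have [h h_inc [c0 c0P]] := infinite_ramsey (n * m)
  (fun A => [ffun tau : pattern => chi' (fun j => f (vec A tau j))]).
(* [f] may depend on entries beyond [m]; setting them to 0 makes its arguments agree with those
   built by [vec]. *)
pose trunc u i := if i < m then u i else 0.
pose F x := f (trunc (h \o g x)).
have F_homo : {homo F : x y / (x < y)%O}.
  move=> x y /g_mono/(lexlt_homo h_inc) lt_xy; apply: f_mono.
  rewrite (eq_lexlt (u' := h \o g x) (v' := h \o g y)) // => i lt_im;
    by rewrite /trunc lt_im.
exists (range F); first by exists F => //; apply: order_embedding_homo.
have chiE : (chi @` Emb_in (range F) `<=` c0 @` [set: pattern])%classic.
  move=> _ [e e_in <-]; have /choice[x xE] j : exists x, F x = sval e j.
    by have [x _] := e_in j; exists x.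
  pose v := [seq g (x p.1) p.2 | p : 'I_n * 'I_m <- enum {: 'I_n * 'I_m}].
  have [B [B_sorted B_size B_sub]] := exists_sorted_cover v.
  have {}B_size : size B = n * m.
    by rewrite B_size size_map -cardE card_prod !card_ord.
  have memB (p : 'I_n * 'I_m) : g (x p.1) p.2 \in B.
    by apply: B_sub; apply: (map_f (fun p : 'I_n * 'I_m => g (x p.1) p.2)); rewrite mem_enum.
  have idx_lt (p : 'I_n * 'I_m) : index (g (x p.1) p.2) B < n * m.
    by rewrite -B_size index_mem.
  pose tau : pattern := [ffun p => Ordinal (idx_lt p)].
  exists tau => //; rewrite -(c0P B B_sorted B_size) ffunE.
  have eE : (fun j => f (vec (map h B) tau j)) = sval e.
    apply/funext => j; rewrite -xE /F; congr f; apply/funext => i.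
    rewrite /vec /trunc; case: insubP => [i' lt_im i'E|/negPf->//].
    rewrite lt_im ffunE (nth_map 0) /= ?index_mem ?(memB (j, i')) //.
    by rewrite nth_index ?(memB (j, i')) // i'E.
  rewrite eE /chi'; case: pselect => [emb|]; last by case; exact: (svalP e).
  by congr chi; case: e emb {e_in xE eE} => e e_emb emb; apply: eq_exist.
apply: card_le_trans (subset_card_le chiE) _.
apply: card_le_trans (card_image_le _ _) _.
apply/pcard_leP/injfunPex; exists (@nat_of_ord _ \o enum_rank).
  by move=> tau _ /=; rewrite ltnS ltnW.
by move=> tau tau' _ _ /val_inj/enum_rank_inj.
Qed.

Theorem corollary5p10 (d : Order.disp_t) (S : orderType d)
    (S_countable : countable [set: S]%classic)
    (S_scattered : scattered S)
    (S_finite_rank : finite_hausdorff_rank S)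
    (T1_eq_1 : big_ramsey_degree 1 S = Some 1) :
  finite_big_ramsey_spectrum S.
Proof.
move=> n n_gt0.
suff [t t_gt0 tP] : exists2 t, 1 <= t & big_ramsey_bound n S t.
  rewrite /big_ramsey_degree; case: pselect => [ex_t|[]]; first by eexists.
  by exists t; rewrite t_gt0; apply/asboolP.
have bound1 : big_ramsey_bound 1 S 1.
  move: T1_eq_1; rewrite /big_ramsey_degree; case: pselect => // ex_t [].
  by case: ex_minnP => t /andP[_ /asboolP tP] _ tE; rewrite tE in tP.
have [[x0 _]|noS] := pselect (exists x : S, True); last first.
  (* In an empty chain there are no tuples to colour, as [n] is positive. *)
  exists 1 => // k _ chi; exists setT; first by exists id => //; apply/image_id.
  rewrite (_ : image _ _ = set0) ?card_ge0 //.
  by apply/seteqP; split=> // c [e _ _]; case: noS; exists (sval e (Ordinal n_gt0)).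
have [r [/hausdorff_word_colouring/(_ (leqnn r))[col colP] _]] :=
  S_finite_rank.
have [F1 F1_homo F1_col] := big_ramsey_bound_indivisible col bound1.
have [[[p g] [g_lt g_mono]] f_ex] := colP (col (F1 x0)).
have [|f f_mono] := f_ex; first by exists (F1 x0).
have copy_lt x : g (F1 x) 0 < p by apply: g_lt.
have [F2 F2_homo F2_copy] :=
  big_ramsey_bound_indivisible (fun x => Ordinal (copy_lt x)) bound1.
pose g2 x := g (F1 (F2 x)) \o succn.
apply: (@big_ramsey_bound_word n d S _ g2 f _ f_mono).
move=> x y /F2_homo/F1_homo lt_xy.
have := g_mono _ _ (F1_col _ _) (F1_col _ _) lt_xy.
by rewrite lexlt_cons /=; case: (F2_copy x y) => ->; rewrite ltnn eqxx.
Qed.
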